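(* Let $G=(V=[n],E)$ be a graph with positive node weights $w\in\mathbb{R}^V$, and let $B\in\mathcal{M}(G,w)$. Let $x\in\Delta_n$ with support $S=\{i\in[n]:x_i\ne0\}$ and let $C_1,\dots,C_k$ denote the connected components (vertex sets) of the induced subgraph $G[S]$. Then $x$ is a global minimizer of the problem $\min\{y^TBy:y\in\Delta_n\}$ (whose optimal value is $1/\alpha(G,w)$) if and only if the following conditions hold: (i) $w_i=w_j$ for all $i,j\in C_h$ and $h\in[k]$, (ii) $C_h$ is a clique of $G$ for all $h\in[k]$, (iii) $\sum_{i\in C_h}x_i=\frac{w_{i_h}}{\alpha(G,w)}$, where $i_h$ is any given node in $C_h$, for all $h\in[k]$, (iv) $2B_{ij}=B_{ii}+B_{jj}=\frac1{w_i}+\frac1{w_j}$ for all edges $\{i,j\}$ of $G[S]$. In that case all the edges of $G[S]$ are $w$-critical.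
   Context: Graphs are finite and simple. $\Delta_n=\{x\in\mathbb{R}^n:x\ge0,\sum_{i=1}^nx_i=1\}$. For $S\subseteq V$, $w(S)=\sum_{i\in S}w_i$. $\alpha(G,w)$ is the maximum of $w(S)$ over stable sets $S$ of $G$; a stable set attaining it is called $w$-maximum. An edge $\{i,j\}\in E$ is $w$-critical (in $G$) if there exists $R\subseteq V$ such that both $R\cup\{i\}$ and $R\cup\{j\}$ are $w$-maximum stable sets. $\mathcal{M}(G,w)$ is the set of real symmetric $n\times n$ matrices $B$ with $B_{ii}=1/w_i$ for $i\in V$, $B_{ij}\ge\frac12(B_{ii}+B_{jj})$ for $\{i,j\}\in E$, and $B_{ij}=0$ for $i\ne j$, $\{i,j\}\notin E$. It is known that for every $B\in\mathcal{M}(G,w)$ the minimum of $y^TBy$ over $\Delta_n$ is $1/\alpha(G,w)$. *)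

(* Defs.v *)
From HB Require Import structures.
From mathcomp Require Import all_boot all_order all_algebra.
From mathcomp Require Import reals.

Set Implicit Arguments.
Unset Strict Implicit.
Unset Printing Implicit Defensive.

Import Order.TTheory GRing.Theory Num.Theory.
Local Open Scope ring_scope.

(* Finite simple graphs with vertex set {0, ..., n-1}. *)
Record sgraph (n : nat) := SGraph {
  adj :> rel 'I_n;
  adj_sym : symmetric adj;
  adj_irrefl : irreflexive adj }.

Section Defs.
Variables (R : realType) (n : nat).
Implicit Types (G : sgraph n) (w : 'I_n -> R) (S C : {set 'I_n}).
Implicit Types (B : 'M[R]_n) (x y : 'cV[R]_n).

Definition stable G S : bool := [forall i in S, forall j in S, ~~ G i j].

Definition clique G C : bool :=
  [forall i in C, forall j in C, (i != j) ==> G i j].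

(* The edge relation of the induced subgraph G[S], kept on all of 'I_n. *)
Definition induced G S : rel 'I_n :=
  [rel i j | [&& i \in S, j \in S & G i j]].

Definition components G S : {set {set 'I_n}} :=
  equivalence_partition (connect (induced G S)) S.

Definition weight w S : R := \sum_(i in S) w i.

(* The empty set is stable and has weight 0, so the initial value 0 does not
   affect the maximum, whatever the sign of the weights. *)
Definition alpha G w : R :=
  \big[Num.max/0]_(S : {set 'I_n} | stable G S) weight w S.

Definition max_stable G w S : Prop := stable G S /\ weight w S = alpha G w.

Definition critical G w (i j : 'I_n) : Prop :=
  G i j /\ exists T : {set 'I_n},
    max_stable G w (i |: T) /\ max_stable G w (j |: T).

Definition in_M G w B : Prop :=
  [/\ B^T = B,
      forall i, B i i = (w i)^-1,
      forall i j, G i j -> 2^-1 * (B i i + B j j) <= B i j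
    & forall i j, i != j -> ~~ G i j -> B i j = 0].

Definition simplex x : Prop :=
  (forall i, 0 <= x i 0) /\ \sum_i x i 0 = 1.

Definition supp x : {set 'I_n} := [set i | x i 0 != 0].

Definition qform B x : R := (x^T *m B *m x) 0 0.

Definition global_minimizer (f : 'cV[R]_n -> R) (D : 'cV[R]_n -> Prop) x :=
  D x /\ forall y, D y -> f x <= f y.

Definition is_minimum (f : 'cV[R]_n -> R) (D : 'cV[R]_n -> Prop) (m : R) :=
  exists2 x, global_minimizer f D x & f x = m.

End Defs.

(* Main.v *)
(** For an edge [ij], the form is concave along [e_i - e_j]; hence mass can be moved
    between adjacent vertices, without increasing the value, until the support is
    stable. There [x_i^2 / w_i >= 2 l x_i - l^2 w_i] with [l = 1 / alpha] gives the
    bound [1 / alpha], attained at [w_i / alpha] on a maximum stable set.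
    At a minimizer, an edge [ij] inside the support is a direction in which the form
    is constant, so columns [i] and [j] of [B] agree on the support. This forces equal
    weights on [i] and [j] and makes adjacency transitive on the support, so that
    components are cliques, and [(B x)_i = 1 / alpha] becomes
    [x(C) / w_i = 1 / alpha]. Summing over the components, any choice of one vertex
    per component is a maximum stable set, whence the criticality of the edges. *)

Require Import Defs.
From HB Require Import structures.
From mathcomp Require Import all_boot all_order all_algebra.
From mathcomp Require Import reals.
From mathcomp Require Import ring lra.

Set Implicit Arguments.
Unset Strict Implicit.
Unset Printing Implicit Defensive.

Import Order.TTheory GRing.Theory Num.Theory.
Local Open Scope ring_scope.

(** Adding the values at [e] and [- e] cancels the linear term and leaves the sign of [q]. This is
    the local optimality condition on a two-sided segment. *)
Lemma quadratic_ge0_near0 (R : realFieldType) (e d q : R) : 0 < e ->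
  (forall t, - e <= t <= e -> 0 <= t * d *+ 2 + t ^+ 2 * q) -> d = 0 /\ 0 <= q.
Proof.
move=> e0 H.
have q0 : 0 <= q.
  have h1 : 0 <= e * d *+ 2 + e ^+ 2 * q by apply: H; lra.
  have h2 : 0 <= - e * d *+ 2 + (- e) ^+ 2 * q by apply: H; lra.
  have : 0 <= e ^+ 2 * q by nra.
  by rewrite pmulr_rge0 // exprn_gt0.
split=> //.
(* If [d != 0], the step [s = e |d| / (e q + |d|)] satisfies [s q <= |d|], whereas
   nonnegativity at [s] and [- s] forces [2 |d| <= s q]. *)
apply/eqP/negP => /negP dN0; have nd : 0 < `|d| by rewrite normr_gt0.
have D0 : 0 < e * q + `|d| by rewrite ltr_wpDl // mulr_ge0 // ltW.
pose s := e * `|d| / (e * q + `|d|).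
have s0 : 0 < s by rewrite divr_gt0 ?mulr_gt0.
have se : s <= e.
  rewrite ler_pdivrMr // ler_pM2l // lerDr.
  by rewrite mulr_ge0 // ltW.
have sq : s * q <= `|d|.
  rewrite /s mulrAC ler_pdivrMr //; nra.
have h1 : 0 <= s * d *+ 2 + s ^+ 2 * q by apply: H; lra.
have h2 : 0 <= - s * d *+ 2 + (- s) ^+ 2 * q by apply: H; lra.
have : `|d| *+ 2 <= s * q.
  by rewrite -(ler_pM2l s0); case: (ger0P d) => _; lra.
lra.
Qed.

(** * Quadratic forms and transfer of mass between two vertices *)

Section QuadraticForm.
Variables (R : realType) (n : nat).
Implicit Types (B : 'M[R]_n) (x y : 'cV[R]_n) (i j k : 'I_n) (t : R).

(** Mass [t] passes from [j] to [i]; a negative [t] reverses the transfer. *)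
Definition shift x i j t : 'cV[R]_n :=
  x + t *: (delta_mx i 0 - delta_mx j 0).

Lemma qformE B x : qform B x = \sum_i x i 0 * (B *m x) i 0.
Proof. by rewrite /qform -mulmxA mxE; apply: eq_bigr => i _; rewrite mxE. Qed.

Lemma shiftE x i j t k :
  shift x i j t k 0 = x k 0 + t * ((k == i)%:R - (k == j)%:R).
Proof. by rewrite !mxE !andbT. Qed.

Lemma mulmx_shift B x i j t k :
  (B *m shift x i j t) k 0 = (B *m x) k 0 + t * (B k i - B k j).
Proof.
by rewrite mulmxDr -scalemxAr mulmxBr -!colE !mxE.
Qed.

Lemma sum_shift x i j t (f : 'I_n -> R) :
  \sum_k shift x i j t k 0 * f k = \sum_k x k 0 * f k + t * (f i - f j).
Proof.
under eq_bigr do rewrite shiftE mulrDl.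
rewrite big_split /=; congr (_ + _).
under eq_bigr do rewrite -mulrA mulrBl.
rewrite -mulr_sumr sumrB; congr (_ * (_ - _)).
  by rewrite (bigD1 i) //= eqxx mul1r big1 ?addr0 // => k /negbTE ->; rewrite mul0r.
by rewrite (bigD1 j) //= eqxx mul1r big1 ?addr0 // => k /negbTE ->; rewrite mul0r.
Qed.

(** The coefficient of [t ^+ 2] is the value of the form at [e_i - e_j]. *)
Lemma qform_shift B x i j t : B^T = B ->
  qform B (shift x i j t) =
  qform B x + (t * ((B *m x) i 0 - (B *m x) j 0) *+ 2
               + t ^+ 2 * (B i i + B j j - B i j *+ 2)).
Proof.
move=> symB; rewrite !qformE.
under eq_bigr do rewrite mulmx_shift mulrDr.
rewrite big_split /= !sum_shift.
under [in X in _ + X]eq_bigr do rewrite mulrCA.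
rewrite -mulr_sumr.
have tB k l : B k l = B l k by rewrite -{1}symB mxE.
have colB k : \sum_l x l 0 * B l k = (B *m x) k 0.
  by rewrite mxE; apply: eq_bigr => l _; rewrite mulrC tB.
have -> : \sum_k x k 0 * (B k i - B k j) = (B *m x) i 0 - (B *m x) j 0.
  by rewrite -!colB -sumrB; apply: eq_bigr => k _; rewrite mulrBr.
rewrite (tB j i); ring.
Qed.

Lemma simplex_shift x i j t : i != j -> simplex x ->
  - x i 0 <= t <= x j 0 -> simplex (shift x i j t).
Proof.
move=> ij [x0 x1] /andP[ti tj]; split=> [k|].
  rewrite shiftE; have := x0 k.
  have [->|ki] := eqVneq k i; first by rewrite (negbTE ij) subr0 mulr1 => _; lra.
  have [->|kj] := eqVneq k j; first by rewrite sub0r mulrN1 => _; lra.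
  by rewrite subrr mulr0 addr0.
(* The constant function 1 yields conservation of the total mass. *)
have := sum_shift x i j t (fun=> 1).
by rewrite subrr mulr0 addr0; under eq_bigr do rewrite mulr1;
  under [in X in _ = X]eq_bigr do rewrite mulr1; move=> ->.
Qed.

Lemma supp_sum x (f : 'I_n -> R) :
  \sum_k x k 0 * f k = \sum_(k in supp x) x k 0 * f k.
Proof.
rewrite big_mkcond [RHS]big_mkcond; apply: eq_bigr => k _ /=.
by rewrite inE; case: eqP => //= ->; rewrite mul0r.
Qed.

Lemma simplex_supp_gt0 x i : simplex x -> i \in supp x -> 0 < x i 0.
Proof. by case=> x0 _; rewrite inE lt0r x0 andbT. Qed.

Lemma simplex_supp_sum x : simplex x -> \sum_(k in supp x) x k 0 = 1.
Proof.
case=> _ <-; have := supp_sum x (fun=> 1).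
by under eq_bigr do rewrite mulr1; under [in X in _ = X]eq_bigr do rewrite mulr1;
  move=> ->.
Qed.

Lemma simplex_inhabited x : simplex x -> exists i, i \in supp x.
Proof.
move=> xD; apply/set0Pn; apply/eqP => S0.
by have := simplex_supp_sum xD; rewrite S0 big_set0 => /eqP; rewrite eq_sym oner_eq0.
Qed.

End QuadraticForm.

(** * Stable sets of maximum weight *)

Section StableSets.
Variables (R : realType) (n : nat) (G : sgraph n) (w : 'I_n -> R).
Hypothesis w_gt0 : forall i, 0 < w i.

Lemma stableP (S : {set 'I_n}) :
  reflect {in S &, forall i j, ~~ G i j} (stable G S).
Proof.
apply: (iffP forall_inP) => [H i j iS jS|H i iS]; last first.
  by apply/forall_inP => j; apply: H.
by have /forall_inP := H i iS; apply.
Qed.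

Lemma weight_le_alpha (S : {set 'I_n}) : stable G S -> weight w S <= alpha G w.
Proof. exact: le_bigmax_cond. Qed.

Lemma weight_ge0 (S : {set 'I_n}) : 0 <= weight w S.
Proof. by apply: sumr_ge0 => i _; apply: ltW. Qed.

Lemma max_stable_exists : exists S : {set 'I_n}, max_stable G w S.
Proof.
have st0 : stable G set0 by apply/stableP => i j; rewrite inE.
have [S stS eS] := @eq_bigmax _ _ _ 0 set0 (stable G) (weight w) st0
  (fun S _ => weight_ge0 S).
by exists S; split.
Qed.

Lemma alpha_gt0 (i : 'I_n) : 0 < alpha G w.
Proof.
apply: lt_le_trans (w_gt0 i) _.
have -> : w i = weight w [set i] by rewrite /weight big_set1.
apply: weight_le_alpha; apply/stableP => j k; rewrite !inE => /eqP-> /eqP->.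
by rewrite adj_irrefl.
Qed.

End StableSets.

(** * The minimum of the form over the simplex *)

Section Minimum.
Variables (R : realType) (n : nat) (G : sgraph n) (w : 'I_n -> R).
Hypothesis w_gt0 : forall i, 0 < w i.
Variable B : 'M[R]_n.
Hypothesis BM : in_M G w B.
Implicit Types (x y : 'cV[R]_n) (i j k : 'I_n).

Lemma in_M_edge i j : G i j -> B i i + B j j <= B i j *+ 2.
Proof. by move=> Gij; have [_ _ /(_ _ _ Gij) h _] := BM; lra. Qed.

Lemma in_M_edge_gt0 i j : G i j -> 0 < B i j.
Proof.
move=> /in_M_edge; have [_ Bd _ _] := BM.
have : 0 < B i i by rewrite Bd invr_gt0.
have : 0 < B j j by rewrite Bd invr_gt0.
lra.
Qed.

Lemma mulmx_stable x i : stable G (supp x) -> i \in supp x ->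
  (B *m x) i 0 = x i 0 / w i.
Proof.
have [_ Bd _ B0] := BM => /stableP st iS.
rewrite mxE (bigD1 i) //= Bd mulrC big1 ?addr0 // => k ki.
have [kS|] := boolP (k \in supp x); last by rewrite inE negbK => /eqP ->; rewrite mulr0.
by rewrite B0 ?mul0r ?st // eq_sym.
Qed.

Lemma qform_stable x : stable G (supp x) ->
  qform B x = \sum_(i in supp x) x i 0 ^+ 2 / w i.
Proof.
move=> st; rewrite qformE (supp_sum x (fun k => (B *m x) k 0)).
by apply: eq_bigr => i iS; rewrite mulmx_stable // mulrA -expr2.
Qed.

Lemma qform_stable_ge x : simplex x -> stable G (supp x) ->
  (alpha G w)^-1 <= qform B x.
Proof.
move=> xD st; rewrite qform_stable //.
have [i _] := simplex_inhabited xD.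
have a0 := alpha_gt0 G w_gt0 i.
set l := (alpha G w)^-1; have l0 : 0 < l by rewrite invr_gt0.
(* Tangent-line bound for [x ^+ 2 / w] at [x = l * w], equivalent to [0 <= (x - l * w) ^+ 2]. *)
have H : \sum_(i in supp x) (l *+ 2 * x i 0 - l ^+ 2 * w i)
    <= \sum_(i in supp x) x i 0 ^+ 2 / w i.
  apply: ler_sum => k _; rewrite ler_pdivlMr //.
  have := sqr_ge0 (x k 0 - l * w k); lra.
apply: le_trans H; rewrite sumrB -!mulr_sumr simplex_supp_sum //.
have : l ^+ 2 * weight w (supp x) <= l ^+ 2 * alpha G w.
  by rewrite ler_pM2l ?exprn_gt0 // weight_le_alpha.
by rewrite {2}expr2 -mulrA mulVf ?gt_eqF // /weight; lra.
Qed.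

Lemma qform_ge x : simplex x -> (alpha G w)^-1 <= qform B x.
Proof.
have [symB _ _ _] := BM.
have [m] := ubnP #|supp x|; elim: m x => // m IH x.
rewrite ltnS => le_m xD.
have [st|/forall_inPn[i iS /forall_inPn[j jS /negPn Gij]]] := boolP (stable G (supp x)).
  exact: qform_stable_ge.
have ij : i != j by apply: contraTneq Gij => ->; rewrite adj_irrefl.
(* By symmetry, mass may be moved towards the end with the smaller entry of [B *m x], which makes
   the linear term nonpositive. *)
wlog d0 : i j iS jS Gij ij / (B *m x) i 0 - (B *m x) j 0 <= 0.
  move=> W; have [|/ltW d0] := lerP ((B *m x) i 0 - (B *m x) j 0) 0; first exact: W.
  by apply: (W j i) => //; rewrite 1?adj_sym 1?eq_sym // -opprB oppr_le0.
have xi := simplex_supp_gt0 xD iS; have xj := simplex_supp_gt0 xD jS.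
(* Moving all the mass of [j] onto [i] removes [j] from the support and adds no vertex. *)
pose y := shift x i j (x j 0).
have yD : simplex y by apply: simplex_shift => //; rewrite lexx andbT; lra.
have ylt : (#|supp y| < #|supp x|)%N.
  apply/proper_card/properP; split; last first.
    exists j => //; rewrite inE negbK shiftE eqxx (eq_sym j) (negbTE ij).
    by rewrite sub0r mulrN1 subrr.
  apply/subsetP => k; rewrite inE shiftE; apply: contraR => kS.
  have [ki kj] : k != i /\ k != j by split; apply: contraNneq kS => ->.
  rewrite (negbTE ki) (negbTE kj) subrr mulr0 addr0.
  by move: kS; rewrite inE negbK.
apply: le_trans (IH y (leq_trans ylt le_m) yD) _.
have := in_M_edge Gij.
rewrite qform_shift //; nra.
Qed.

Lemma qform_minimum : (exists x, @simplex R n x) ->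
  exists2 x, @simplex R n x & qform B x = (alpha G w)^-1.
Proof.
case=> x0 /simplex_inhabited[i0 _]; have a0 := alpha_gt0 G w_gt0 i0.
have [S [stS wS]] := max_stable_exists G w_gt0.
pose x : 'cV[R]_n := \col_i (if i \in S then w i / alpha G w else 0).
have sx : supp x = S.
  apply/setP => i; rewrite inE mxE; case: ifP => _; last by rewrite eqxx.
  by rewrite mulf_eq0 invr_eq0 !gt_eqF.
exists x; last first.
  rewrite qform_stable ?sx //.
  rewrite (eq_bigr (fun i => (alpha G w)^-2 * w i)) => [|i iS].
    by rewrite -mulr_sumr -/(weight w S) wS; field; rewrite gt_eqF.
  by rewrite mxE iS; field; rewrite !gt_eqF.
split=> [i|]; first by rewrite mxE; case: ifP => // _; rewrite divr_ge0 // ltW.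
under eq_bigr do rewrite mxE.
by rewrite -big_mkcond -mulr_suml -/(weight w S) wS mulfV // gt_eqF.
Qed.

Lemma global_minimizerE x : simplex x ->
  global_minimizer (qform B) (@simplex R n) x <-> qform B x = (alpha G w)^-1.
Proof.
move=> xD; split=> [[_ H]|E]; last by split=> // y yD; rewrite E qform_ge.
have [y yD Ey] := qform_minimum (ex_intro _ x xD).
by apply/eqP; rewrite eq_le qform_ge // andbT -Ey H.
Qed.

End Minimum.

(** * Connected components of an induced subgraph *)

Section Components.
Variables (n : nat) (G : sgraph n) (S : {set 'I_n}).
Implicit Types i j k : 'I_n.

Lemma induced_connect_sym : connect_sym (induced G S).
Proof.
by apply: sym_connect_sym => i j; rewrite [LHS]andbCA [RHS]/= adj_sym.
Qed.

Lemma induced_connect_mem i j : i \in S -> connect (induced G S) i j -> j \in S.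
Proof.
move=> iS /connectP[p]; elim: p i iS => [|k p IH] i iS /=; first by move=> _ ->.
by case/andP=> /and3P[_ kS _]; apply: IH.
Qed.

(** A path of [induced G S] from a vertex of [S] stays in [S], so the block of [i] is everything
    reachable from [i]. *)
Lemma mem_components i : i \in S ->
  [set k | connect (induced G S) i k] \in components G S.
Proof.
move=> iS; apply/imsetP; exists i => //; apply/setP => k; rewrite !inE.
by case: (boolP (connect _ _ _)) => [/(induced_connect_mem iS)->|]; rewrite ?andbF.
Qed.

Lemma componentsE (C : {set 'I_n}) i : C \in components G S -> i \in C ->
  i \in S /\ C = [set k | connect (induced G S) i k].
Proof.
move=> /imsetP[j jS ->]; rewrite inE => /andP[iS ji]; split=> //.
apply/setP => k; rewrite !inE -(same_connect induced_connect_sym ji).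
by case: (boolP (connect _ _ _)) => [/(induced_connect_mem jS)->|]; rewrite ?andbF.
Qed.

End Components.

(** * Optimality conditions at a minimizer *)

Section Minimizers.
Variables (R : realType) (n : nat) (G : sgraph n) (w : 'I_n -> R).
Hypothesis w_gt0 : forall i, 0 < w i.
Variable B : 'M[R]_n.
Hypothesis BM : in_M G w B.
Implicit Types (x : 'cV[R]_n) (i j k : 'I_n).

(** Row [i] of [B] vanishes on the support outside the component of [i]. Serves both directions of
    the equivalence. *)
Lemma mulmx_component x i : i \in supp x ->
  (forall k, connect (induced G (supp x)) i k -> B i k = (w i)^-1) ->
  (B *m x) i 0 = (\sum_(k | connect (induced G (supp x)) i k) x k 0) / w i.
Proof.
move=> iS Bi; have [_ _ _ B0] := BM.
rewrite mxE mulr_suml [RHS]big_mkcond; apply: eq_bigr => k _.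
case: ifPn => [/Bi ->|Nik]; first by rewrite mulrC.
have [kS|] := boolP (k \in supp x); last first.
  by rewrite inE negbK => /eqP ->; rewrite mulr0.
rewrite B0 ?mul0r //; first by apply: contraNneq Nik => ->.
by apply: contraNN Nik => Gik; apply/connect1/and3P.
Qed.

Section Necessity.
Variable x : 'cV[R]_n.
Hypotheses (xD : simplex x) (xmin : qform B x = (alpha G w)^-1).

(** Both vertices carry mass, so [x] can be shifted along [e_i - e_j] in both directions: the
    derivative vanishes and the second-order coefficient is nonnegative. *)
Lemma minimizer_pair i j : i \in supp x -> j \in supp x -> i != j ->
  (B *m x) i 0 = (B *m x) j 0 /\ B i j *+ 2 <= B i i + B j j.
Proof.
move=> iS jS ij; have [symB _ _ _] := BM.
have xi := simplex_supp_gt0 xD iS; have xj := simplex_supp_gt0 xD jS.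
pose e := Num.min (x i 0) (x j 0).
have e0 : 0 < e by rewrite lt_min xi.
have [ei ej] : e <= x i 0 /\ e <= x j 0 by rewrite !ge_min !lexx orbT.
have [|d0 q0] := quadratic_ge0_near0
  (d := (B *m x) i 0 - (B *m x) j 0)
  (q := B i i + B j j - B i j *+ 2) e0.
- move=> t /andP[te1 te2]; have yD : simplex (shift x i j t).
    by apply: simplex_shift => //; apply/andP; split; lra.
  by have := qform_ge w_gt0 BM yD; rewrite qform_shift // xmin; lra.
- by split; [apply/eqP; rewrite -subr_eq0 d0|lra].
Qed.

(** The entries of [B *m x] on the support coincide, and their average weighted by [x] is the value
    of the form. *)
Lemma minimizer_mulmx i : i \in supp x -> (B *m x) i 0 = (alpha G w)^-1.
Proof.
move=> iS; rewrite -xmin qformE (supp_sum x (fun k => (B *m x) k 0)).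
rewrite (eq_bigr (fun k => x k 0 * (B *m x) i 0)) => [|k kS].
  by rewrite -mulr_suml simplex_supp_sum // mul1r.
by have [->//|ki] := eqVneq k i; have [-> _] := minimizer_pair kS iS ki.
Qed.

(** Second-order minimality bounds [B i j] from above, the edge condition of [in_M] from below. *)
Lemma minimizer_edge i j : i \in supp x -> j \in supp x -> G i j ->
  B i j *+ 2 = B i i + B j j.
Proof.
move=> iS jS Gij.
have ij : i != j by apply: contraTneq Gij => ->; rewrite adj_irrefl.
have [_ le] := minimizer_pair iS jS ij.
by apply/eqP; rewrite eq_le le (in_M_edge BM).
Qed.

End Necessity.

(* Along an edge [ij] of the support the form is constant, so a point slightly
   shifted along [e_i - e_j] is a minimizer with the same support; comparing the
   optimality conditions [(B x)_k = 1 / alpha] of both points gives the claim. *)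
Lemma minimizer_column_eq x i j k : simplex x -> qform B x = (alpha G w)^-1 ->
  i \in supp x -> j \in supp x -> k \in supp x -> G i j -> B k i = B k j.
Proof.
move=> xD xmin iS jS kS Gij; have [symB _ _ _] := BM.
have ij : i != j by apply: contraTneq Gij => ->; rewrite adj_irrefl.
have xi := simplex_supp_gt0 xD iS; have xj := simplex_supp_gt0 xD jS.
(* Half of [x j 0] leaves positive mass at both [i] and [j]. *)
pose t := x j 0 / 2; have t0 : 0 < t by rewrite /t; lra.
have yD : simplex (shift x i j t).
  by apply: simplex_shift => //; apply/andP; split; rewrite /t; lra.
have ymin : qform B (shift x i j t) = (alpha G w)^-1.
  rewrite qform_shift // xmin !(minimizer_mulmx xD xmin) //.
  by rewrite (minimizer_edge xD xmin) // !subrr !mulr0 mul0rn !addr0.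
have kT : k \in supp (shift x i j t).
  rewrite inE shiftE; have xk := simplex_supp_gt0 xD kS.
  have [ki|ki] := eqVneq k i; have [kj|kj] := eqVneq k j; rewrite gt_eqF //.
  - by rewrite subrr mulr0 addr0.
  - by rewrite subr0 mulr1 addr_gt0.
  - by rewrite kj sub0r mulrN1 /t; lra.
  - by rewrite subrr mulr0 addr0.
have := minimizer_mulmx yD ymin kT.
rewrite mulmx_shift (minimizer_mulmx xD xmin) // -[RHS]addr0 => /addrI/eqP.
by rewrite mulf_eq0 gt_eqF //= subr_eq0 => /eqP.
Qed.

(** * Clique components, their masses, and critical edges *)

Section Structure.
Variable x : 'cV[R]_n.
Hypotheses (xD : simplex x) (xmin : qform B x = (alpha G w)^-1).
Let e := induced G (supp x).

(** The edge [jk] gives [B i j = B i k]; the left side is positive as [ij] is an edge, whereas a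
    non-edge [ik] would make the right side 0. *)
Lemma minimizer_trans i j k : e i j -> e j k -> i != k -> e i k.
Proof.
move=> /and3P[iS jS Gij] /and3P[_ kS Gjk] ik; apply/and3P; split=> //.
have [symB _ _ B0] := BM.
have := minimizer_column_eq xD xmin jS kS iS Gjk.
apply: contraPT => /(B0 _ _ ik) ->; apply/eqP.
by rewrite gt_eqF // (in_M_edge_gt0 w_gt0 BM) // (adj_sym G).
Qed.

Lemma minimizer_connect i j : connect e i j -> i != j -> G i j.
Proof.
(* Transitivity contracts a path to a single edge, or to a point when it returns to its start. *)
move=> /connectP[p]; suff H : path e i p -> i = last i p \/ e i (last i p).
  by move=> /H[<- ->|/and3P[_ _ Gij] -> _ //]; rewrite eqxx.
elim: p i => [|k p IH] i /=; first by left.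
case/andP=> eik /IH[<-|ekl]; first by right.
by have [<-|ne] := eqVneq i (last k p); [left|right; apply: minimizer_trans ekl ne].
Qed.

(** Columns [i] and [j] agree in rows [i] and [j], so by symmetry [B i i = B i j = B j j]. *)
Lemma minimizer_entry i j : i \in supp x -> connect e i j ->
  B i j = (w i)^-1 /\ w i = w j.
Proof.
move=> iS cij; have jS := induced_connect_mem iS cij.
have [symB Bd _ _] := BM.
have [<-|ij] := eqVneq i j; first by rewrite Bd.
have Gij := minimizer_connect cij ij.
have Eij := minimizer_column_eq xD xmin iS jS iS Gij.
have Eji := minimizer_column_eq xD xmin iS jS jS Gij.
have tB : B i j = B j i by rewrite -[in LHS]symB mxE.
split; first by rewrite -Eij Bd.
by apply: invr_inj; rewrite -!Bd Eij tB.
Qed.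

(** Compares two values of [(B *m x) i 0]: [1 / alpha] by optimality, and the mass of the component
    over [w i]. *)
Lemma minimizer_mass i : i \in supp x ->
  \sum_(k | connect e i k) x k 0 = w i / alpha G w.
Proof.
move=> iS; have := minimizer_mulmx xD xmin iS.
rewrite mulmx_component // => [|k /(minimizer_entry iS)[]//] <-.
by rewrite mulrCA mulfV ?mulr1 // gt_eqF.
Qed.

(* [i] together with one vertex from every other component of the support. *)
Definition representatives i : {set 'I_n} :=
  i |: [set k in supp x | roots e k & ~~ connect e i k].

(** Adjacent support vertices share a component, which gives stability. The component masses
    [w l / alpha] add up to 1, which gives the weight. *)
Lemma representatives_max_stable i : i \in supp x ->
  max_stable G w (representatives i).
Proof.
move=> iS; set T := representatives i.
have symc := induced_connect_sym G (supp x).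
(* [r] sends a vertex to the representative of its component: [i] for the component of [i], the
   canonical root elsewhere. *)
pose r k := if connect e i k then i else fingraph.root e k.
have rc k : connect e (r k) k.
  by rewrite /r; case: ifP => // _; rewrite symc connect_root.
have rK k l : connect e k l -> r k = r l.
  by move=> kl; rewrite /r (same_connect_r symc kl) (fingraph.rootP symc kl).
have rT k : k \in T -> r k = k.
  rewrite !inE => /predU1P[->|/and3P[_ /eqP kr /negbTE Nik]].
    by rewrite /r connect0.
  by rewrite /r Nik.
have Tr k : k \in supp x -> r k \in T.
  move=> kS; rewrite /r; case: ifPn => Nik; first by rewrite !inE eqxx.
  have ck := connect_root e k.
  by rewrite !inE -(in_set (fun k => x k 0 != 0)) (induced_connect_mem kS ck)
    roots_root // -(same_connect_r symc ck) Nik orbT.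
have TS k : k \in T -> k \in supp x.
  by rewrite !inE => /predU1P[->|/and3P[]//]; move: iS; rewrite inE.
split.
  apply/stableP => k l kT lT; apply/negP => Gkl.
  have : connect e k l by apply/connect1/and3P; split; rewrite ?TS.
  by move/rK; rewrite !rT // => kl; move: Gkl; rewrite kl adj_irrefl.
have a0 := alpha_gt0 G w_gt0 i.
(* The support is split into the fibres of [r]; the fibre over [l] is the component of [l]. *)
have : \sum_(k in supp x) x k 0 = \sum_(l in T) w l / alpha G w.
  rewrite (partition_big r (mem T)) //=; apply: eq_bigr => l lT.
  rewrite -(minimizer_mass (TS l lT)); apply: eq_bigl => k.
  apply/andP/idP => [[_ /eqP<-]//|clk].
  by rewrite (induced_connect_mem (TS l lT) clk) -(rK _ _ clk) rT.
rewrite simplex_supp_sum // -mulr_suml -/(weight w T) => E.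
by rewrite -[weight w T](mulfVK (lt0r_neq0 a0)) -E mul1r.
Qed.

Lemma minimizer_critical i j : e i j -> critical G w i j.
Proof.
move=> eij; have /and3P[iS jS Gij] := eij; split=> //.
(* The ends of an edge lie in the same component, so the representatives of the other components are
   the same for [i] and [j]. *)
exists [set k in supp x | roots e k & ~~ connect e i k]; split.
  exact: representatives_max_stable.
have := representatives_max_stable jS; rewrite /representatives.
under eq_finset do rewrite -(same_connect (induced_connect_sym _ _) (connect1 eij)).
by [].
Qed.

End Structure.

End Minimizers.

Theorem proposition4p3 (R : realType) (n : nat) (G : sgraph n) (w : 'I_n -> R)
    (w_gt0 : forall i, 0 < w i) (B : 'M[R]_n) (BM : in_M G w B)
    (x : 'cV[R]_n) (xD : simplex x) :
  [/\ is_minimum (qform B) (@simplex R n) (1 / alpha G w),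
      global_minimizer (qform B) (@simplex R n) x <->
      [/\ forall C, C \in components G (supp x) ->
            forall i j, i \in C -> j \in C -> w i = w j,
          forall C, C \in components G (supp x) -> clique G C,
          forall C, C \in components G (supp x) ->
            forall ih, ih \in C -> \sum_(i in C) x i 0 = w ih / alpha G w
        & forall i j, induced G (supp x) i j ->
            2 * B i j = B i i + B j j /\ B i i + B j j = 1 / w i + 1 / w j]
    & global_minimizer (qform B) (@simplex R n) x ->
      forall i j, induced G (supp x) i j -> critical G w i j].
Proof.
have minE := global_minimizerE w_gt0 BM.
have [_ Bd _ _] := BM.
split; last by move=> /(minE _ xD) xmin i j;
  exact: (minimizer_critical w_gt0 BM xD xmin).
  have [y yD Ey] := qform_minimum w_gt0 BM (ex_intro _ x xD).
  by exists y; rewrite ?div1r //; apply/minE.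
split=> [/(minE _ xD) xmin|[H1 H2 H3 H4]].
  split=> [C CS i j iC|C CS|C CS i iC|i j /and3P[iS jS Gij]].
  - have [iS ->] := componentsE CS iC; rewrite inE => cij.
    by have [] := minimizer_entry w_gt0 BM xD xmin iS cij.
  - apply/forall_inP => i iC; apply/forall_inP => j.
    have [iS ->] := componentsE CS iC; rewrite inE => cij; apply/implyP.
    exact: (minimizer_connect w_gt0 BM xD xmin cij).
  - have [iS ->] := componentsE CS iC.
    by rewrite -(minimizer_mass w_gt0 BM xD xmin iS); apply: eq_bigl => k; rewrite inE.
  - by rewrite mulr_natl (minimizer_edge w_gt0 BM xD xmin) // !Bd !div1r.
apply/minE => //.
(* Conditions (i), (ii) and (iv) make row [i] of [B] equal to [1 / w i] on the component of [i]; the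
   mass in (iii) then gives the entry of [B *m x]. *)
have Bx i : i \in supp x -> (B *m x) i 0 = (alpha G w)^-1.
  move=> iS; have CS := mem_components G iS.
  have iC : i \in [set k | connect (induced G (supp x)) i k] by rewrite inE.
  rewrite (mulmx_component BM) // => [|k cik].
    have := H3 _ CS _ iC; under eq_bigl do rewrite inE.
    by move=> ->; rewrite mulrAC mulfV ?mul1r // gt_eqF.
  have kC : k \in [set k | connect (induced G (supp x)) i k] by rewrite inE.
  have [<-//|ik] := eqVneq i k.
  have eik : induced G (supp x) i k.
    apply/and3P; split; rewrite ?(induced_connect_mem iS cik) //.
    by have /forall_inP/(_ i iC)/forall_inP/(_ k kC)/implyP-> := H2 _ CS.
  have [+ _] := H4 _ _ eik; rewrite !Bd -(H1 _ CS _ _ iC kC); lra.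
rewrite qformE (supp_sum x (fun k => (B *m x) k 0)).
rewrite (eq_bigr (fun k => x k 0 * (alpha G w)^-1)) => [|k /Bx -> //].
by rewrite -mulr_suml simplex_supp_sum // mul1r.
Qed.
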